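(* Let $A\to B\to C$ be a sequence of ring homomorphisms, and let $m\in\mathbb N\cup\{\infty\}$. Assume that $B\to C$ is surjective, and let $I$ be its kernel. Let $J$ be the ideal of $\mathrm{HS}^m_{B/A}$ generated by all $d_ix$ with $x\in I$ and $i=0,\dots,m$. Then the sequence $$0 \to J \to \mathrm{HS}^m_{B/A} \to \mathrm{HS}^m_{C/A} \to 0$$ is an exact sequence of graded $B$-modules.
   Context: All rings and algebras are commutative with $1$; $\mathbb N$ contains $0$; when $m=\infty$, ''$i=1,\dots,m$'' means all positive integers $i$ (and ''$i=0,\dots,m$'' all $i\ge 0$). For a ring homomorphism $f\colon A\to B$, $\mathrm{HS}^m_{B/A}$ is the quotient of the polynomial algebra $B[x^{(i)}]_{x\in B,\ i=1,\dots,m}$ by the ideal generated by: $(x+y)^{(i)}-x^{(i)}-y^{(i)}$ for $x,y\in B$, $i=1,\dots,m$; $f(a)^{(i)}$ for $a\in A$, $i=1,\dots,m$; and $(xy)^{(k)}-\sum_{i+j=k}x^{(i)}y^{(j)}$ for $x,y\in B$, $k=0,\dots,m$, where $x^{(0)}$ is identified with $x$. Write $d_i x$ for the class of $x^{(i)}$ (so $d_0x=x$). $\mathrm{HS}^m_{B/A}$ is a graded $B$-algebra with $B$ in degree $0$ and $d_ix$ of degree $i$. The natural map $\mathrm{HS}^m_{B/A}\to\mathrm{HS}^m_{C/A}$ sends $d_ib$ to $d_i$ of the image of $b$ in $C$; the map $J\to\mathrm{HS}^m_{B/A}$ is the inclusion. *)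

(* Defs.v *)
From HB Require Import structures.
From mathcomp Require Import all_boot all_order all_algebra.
From mathcomp.finmap Require Import finmap.
From mathcomp.classical Require Import boolp.
From mathcomp.multinomials Require Import monalg.

Set Implicit Arguments.
Unset Strict Implicit.
Unset Printing Implicit Defensive.

Import GRing.Theory.
Local Open Scope ring_scope.

(* Rings are [comPzRingType]s: the zero ring is allowed, so [C] may be zero. *)

(* [{malg R[K]}] is the free module on the monomials [K], but multinomials
   makes it a ring only when [1 != 0] in [R]. The alias below carries the same
   product without that restriction. *)
Definition polyalg (I : choiceType) (R : comPzRingType) : Type :=
  {malg R[{cmonom I}]}.

HB.instance Definition _ I R := GRing.Zmodule.on (polyalg I R).

Section PolyalgRing.
Variables (I : choiceType) (R : comPzRingType).
Local Notation K := {cmonom I}.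
Local Notation P := (polyalg I R).
Implicit Types (p q r : P) (k l : K).
Local Open Scope fset_scope.
Local Open Scope ring_scope.

Definition pa_mul_def p q : P :=
  \sum_(k <- msupp p) \sum_(l <- msupp q) << p@_k * q@_l *g mmul k l >>.

Fact pa_mul_key : unit. Proof. by []. Qed.
Definition pa_mul := locked_with pa_mul_key pa_mul_def.
Lemma pa_mulE p q : pa_mul p q =
  \sum_(k <- msupp p) \sum_(l <- msupp q) << p@_k * q@_l *g mmul k l >>.
Proof. by rewrite /pa_mul unlock. Qed.

Definition pa_mono (c : R) (k : K) : P := << c *g k >>.

Definition pa_one : P := pa_mono 1 mone.

Lemma pa_mulw (d1 d2 : {fset K}) p q : msupp p `<=` d1 -> msupp q `<=` d2 ->
  pa_mul p q = \sum_(k <- d1) \sum_(l <- d2) << p@_k * q@_l *g mmul k l >>.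
Proof.
move=> le_d1 le_d2; rewrite pa_mulE (big_fset_incl _ le_d1) /=.
  apply/eq_bigr=> k1 _; apply/big_fset_incl => // k _ /mcoeff_outdom ->.
  by rewrite mulr0 monalgU0.
move=> k _ /mcoeff_outdom g1k.
by rewrite big1 => // k' _; rewrite g1k mul0r monalgU0.
Qed.

Lemma pa_mulC : commutative pa_mul.
Proof.
move=> p q; rewrite !pa_mulE exchange_big /=.
by apply: eq_bigr => l _; apply: eq_bigr => k _; rewrite mulrC mulmC.
Qed.

Lemma pa_mul0 q : pa_mul 0 q = 0.
Proof. by rewrite pa_mulE msupp0 big_seq_fset0. Qed.

Lemma pa_mulDl : left_distributive pa_mul +%R.
Proof.
move=> p q r.
rewrite (pa_mulw (msuppD_le _ _) (fsubset_refl _)).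
rewrite [in RHS](pa_mulw (fsubsetUl _ (msupp q)) (fsubset_refl _)).
rewrite [in RHS](pa_mulw (fsubsetUr (msupp p) _) (fsubset_refl _)).
rewrite -big_split /=; apply/eq_bigr=> k1 _.
rewrite -big_split /=; apply/eq_bigr=> k2 _.
by rewrite mcoeffD mulrDl monalgUD.
Qed.

Lemma pa_mulUU c1 c2 k1 k2 :
  pa_mul (pa_mono c1 k1) (pa_mono c2 k2) = pa_mono (c1 * c2) (mmul k1 k2).
Proof.
by rewrite (pa_mulw msuppU_le msuppU_le) !big_seq_fset1 !mcoeffUU.
Qed.

Lemma pa_ind (Q : P -> Prop) :
  Q 0 -> (forall p q, Q p -> Q q -> Q (p + q)) ->
  (forall c k, Q (pa_mono c k)) -> forall p, Q p.
Proof. move=> Q0 QD QU p; rewrite (monalgE p); apply: big_ind => // k _; exact: QU. Qed.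

Lemma pa_mulDr : right_distributive pa_mul +%R.
Proof. by move=> p q r; rewrite pa_mulC pa_mulDl !(pa_mulC _ p). Qed.

Lemma pa_mul0r p : pa_mul p 0 = 0.
Proof. by rewrite pa_mulC pa_mul0. Qed.

Lemma pa_mul1 : left_id pa_one pa_mul.
Proof.
elim/pa_ind => [|p q IHp IHq|c k]; first exact: pa_mul0r.
  by rewrite pa_mulDr IHp IHq.
by rewrite pa_mulUU mul1r mul1m.
Qed.

Lemma pa_mulA : associative pa_mul.
Proof.
pose Q p q r := pa_mul p (pa_mul q r) = pa_mul (pa_mul p q) r.
have redp q r : (forall c k, Q (pa_mono c k) q r) -> forall p, Q p q r.
  move=> QU; elim/pa_ind => [|p1 p2 IH1 IH2|//]; rewrite /Q.
    by rewrite !pa_mul0.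
  by rewrite !pa_mulDl IH1 IH2.
have redq p r : (forall c k, Q p (pa_mono c k) r) -> forall q, Q p q r.
  move=> QU; elim/pa_ind => [|q1 q2 IH1 IH2|//]; rewrite /Q.
    by rewrite pa_mul0r !pa_mul0 pa_mul0r.
  by rewrite pa_mulDl !pa_mulDr pa_mulDl IH1 IH2.
have redr p q : (forall c k, Q p q (pa_mono c k)) -> forall r, Q p q r.
  move=> QU; elim/pa_ind => [|r1 r2 IH1 IH2|//]; rewrite /Q.
    by rewrite !pa_mul0r.
  by rewrite !pa_mulDr IH1 IH2.
move=> p q r; apply: redp => c k; apply: redq => c' k'; apply: redr => c'' k''.
rewrite /Q; move: pa_mulUU; move: pa_mono => U UU.
by rewrite !UU mulrA mulmA.
Qed.

HB.instance Definition _ := GRing.Zmodule_isComPzRing.Build (polyalg I R)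
  pa_mulA pa_mulC pa_mul1 pa_mulDl.

Definition paC (c : R) : P := pa_mono c mone.
Definition paX (i : I) : P := pa_mono 1 (ucm i).

Lemma paC_zmod : zmod_morphism paC.
Proof. by move=> x y; exact: (raddfB (mkmalgU (mone : K))). Qed.

Lemma paC_monoid : monoid_morphism paC.
Proof. by split=> [//|x y]; rewrite [RHS]pa_mulUU mul1m. Qed.

HB.instance Definition _ := GRing.isZmodMorphism.Build R P paC paC_zmod.
HB.instance Definition _ := GRing.isMonoidMorphism.Build R P paC paC_monoid.

End PolyalgRing.

Section PolyalgEval.
Variables (I : choiceType) (R S : comPzRingType).
Variables (phi : {rmorphism R -> S}) (h : I -> S).
Local Notation K := {cmonom I}.
Local Notation P := (polyalg I R).
Local Open Scope fset_scope.
Local Open Scope ring_scope.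

Definition mon_eval (k : K) : S := \prod_(i <- finsupp k) h i ^+ k i.

Definition pa_eval (p : P) : S :=
  \sum_(k <- msupp p) phi p@_k * mon_eval k.

Lemma mon_evalw (d : {fset I}) (k : K) :
  finsupp k `<=` d -> mon_eval k = \prod_(i <- d) h i ^+ k i.
Proof.
move=> le_d; rewrite /mon_eval (big_fset_incl _ le_d) // => i _.
by rewrite -cmE_neq0 negbK => /eqP ->; rewrite expr0.
Qed.

Lemma mon_eval1 : mon_eval mone = 1.
Proof. by rewrite /mon_eval mdom1 big_seq_fset0. Qed.

Lemma mon_evalU i : mon_eval (ucm i) = h i.
Proof. by rewrite /mon_eval mdomU big_seq_fset1 cmUU expr1. Qed.

Lemma mon_evalM k l : mon_eval (mmul k l) = mon_eval k * mon_eval l.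
Proof.
rewrite (mon_evalw (d := finsupp k `|` finsupp l)) ?mdomD //.
rewrite (mon_evalw (fsubsetUl _ (finsupp l))).
rewrite (mon_evalw (fsubsetUr (finsupp k) _)) -big_split /=.
by apply: eq_bigr => i _; rewrite cmM exprD.
Qed.

Lemma pa_evalw (d : {fset K}) (p : P) :
  msupp p `<=` d -> pa_eval p = \sum_(k <- d) phi p@_k * mon_eval k.
Proof.
move=> le_d; rewrite /pa_eval (big_fset_incl _ le_d) // => k _.
by move=> /mcoeff_outdom ->; rewrite rmorph0 mul0r.
Qed.

Lemma pa_evalU c k : pa_eval (pa_mono c k) = phi c * mon_eval k.
Proof. by rewrite (pa_evalw (d := [fset k]) msuppU_le) big_seq_fset1 mcoeffUU. Qed.

Lemma pa_eval_zmod : zmod_morphism pa_eval.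
Proof.
move=> p q; rewrite (pa_evalw (msuppB_le p q)).
rewrite (pa_evalw (fsubsetUl _ (msupp q))).
rewrite (pa_evalw (fsubsetUr (msupp p) _)) -sumrB.
by apply: eq_bigr => k _; rewrite mcoeffB rmorphB mulrBl.
Qed.

HB.instance Definition _ := GRing.isZmodMorphism.Build P S pa_eval pa_eval_zmod.

Lemma pa_eval_monoid : monoid_morphism pa_eval.
Proof.
split=> [|p q]; first by rewrite pa_evalU rmorph1 mon_eval1 mulr1.
have -> : p * q = \sum_(k <- msupp p) \sum_(l <- msupp q)
   << p@_k * q@_l *g mmul k l >> by exact: pa_mulE.
rewrite raddf_sum /= mulr_suml; apply: eq_bigr => k _.
rewrite raddf_sum /= mulr_sumr; apply: eq_bigr => l _.
by rewrite pa_evalU rmorphM mon_evalM mulrACA.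
Qed.

HB.instance Definition _ :=
  GRing.isMonoidMorphism.Build P S pa_eval pa_eval_monoid.

Lemma pa_evalC c : pa_eval (paC I c) = phi c.
Proof. by rewrite pa_evalU mon_eval1 mulr1. Qed.

Lemma pa_evalX i : pa_eval (paX R i) = h i.
Proof. by rewrite pa_evalU rmorph1 mon_evalU mul1r. Qed.

End PolyalgEval.

Section IdealGen.
Variables (R : comPzRingType) (S : R -> Prop).

Definition ideal_gen (r : R) : Prop :=
  exists s : seq (R * R),
    (forall p, p \in s -> S p.2) /\ r = \sum_(p <- s) p.1 * p.2.

Definition ideal_pred : {pred R} := fun r => `[< ideal_gen r >].

Lemma ideal_predP r : reflect (ideal_gen r) (r \in ideal_pred).
Proof. exact: asboolP. Qed.

Lemma ideal_genM a r : ideal_gen r -> ideal_gen (a * r).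
Proof.
case=> s [sS ->]; exists [seq (a * p.1, p.2) | p <- s]; split.
  by move=> p /mapP[q qs ->]; exact: (sS q).
by rewrite big_map mulr_sumr; apply: eq_bigr => p _; rewrite mulrA.
Qed.

Lemma ideal_genD r t : ideal_gen r -> ideal_gen t -> ideal_gen (r + t).
Proof.
case=> s [sS ->] [u [uS ->]]; exists (s ++ u); split; last by rewrite big_cat.
by move=> p; rewrite mem_cat => /orP[/sS|/uS].
Qed.

Lemma ideal_gen0 : ideal_gen 0.
Proof. by exists [::]; split=> //; rewrite big_nil. Qed.

Lemma ideal_gen_mem r : S r -> ideal_gen r.
Proof.
move=> Sr; exists [:: (1, r)]; split; last by rewrite big_seq1 mul1r.
by move=> p; rewrite inE => /eqP ->.
Qed.

Lemma ideal_pred_zmod : zmod_closed ideal_pred.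
Proof.
split; first by apply/ideal_predP; exact: ideal_gen0.
move=> r t /ideal_predP rS /ideal_predP tS; apply/ideal_predP.
by apply: ideal_genD => //; rewrite -mulN1r; exact: ideal_genM.
Qed.

HB.instance Definition _ := GRing.isZmodClosed.Build R ideal_pred ideal_pred_zmod.

(* As for polynomials, the quotient ring of [ring_quotient] excludes the zero
   ring, so only its additive group is reused. *)
Definition ring_quot : Type := Quotient.quot (ideal_pred : zmodClosed R).

HB.instance Definition _ := GRing.Zmodule.on ring_quot.

Definition rq_pi (r : R) : ring_quot :=
  (\pi_(Quotient.quot (ideal_pred : zmodClosed R)) r)%qT.
Definition rq_repr (u : ring_quot) : R :=
  repr (u : Quotient.quot (ideal_pred : zmodClosed R)).

Lemma rq_reprK : cancel rq_repr rq_pi.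
Proof. by move=> u; exact: reprK. Qed.

Lemma rq_piP r t : rq_pi r = rq_pi t <-> ideal_gen (r - t).
Proof.
split=> [e|e].
  by apply/ideal_predP; rewrite Quotient.idealrBE; apply/eqP.
by apply/eqP; rewrite -[_ == _]Quotient.idealrBE; apply/ideal_predP.
Qed.

Lemma rq_pi_zmod : zmod_morphism rq_pi.
Proof. exact: raddfB. Qed.

HB.instance Definition _ := GRing.isZmodMorphism.Build R ring_quot rq_pi rq_pi_zmod.

Definition rq_one : ring_quot := rq_pi 1.
Definition rq_mul (u v : ring_quot) : ring_quot :=
  rq_pi (rq_repr u * rq_repr v).

Lemma rq_pi_mul r t : rq_pi (r * t) = rq_mul (rq_pi r) (rq_pi t).
Proof.
apply/rq_piP.
set r' := rq_repr (rq_pi r); set t' := rq_repr (rq_pi t).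
have -> : r * t - r' * t' = t * (r - r') + r' * (t - t').
  by rewrite !mulrBr addrA [t * r]mulrC [t * r']mulrC subrK.
by apply: ideal_genD; apply: ideal_genM; apply/rq_piP; rewrite rq_reprK.
Qed.

Lemma rq_mulA : associative rq_mul.
Proof.
by move=> u v w; rewrite -(rq_reprK u) -(rq_reprK v) -(rq_reprK w) -!rq_pi_mul mulrA.
Qed.

Lemma rq_mulC : commutative rq_mul.
Proof. by move=> u v; rewrite /rq_mul mulrC. Qed.

Lemma rq_mul1 : left_id rq_one rq_mul.
Proof. by move=> u; rewrite -(rq_reprK u) -rq_pi_mul mul1r. Qed.

Lemma rq_mulDl : left_distributive rq_mul +%R.
Proof.
move=> u v w; rewrite -(rq_reprK u) -(rq_reprK v) -(rq_reprK w).
by rewrite -raddfD -!rq_pi_mul mulrDl raddfD.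
Qed.

HB.instance Definition _ := GRing.Zmodule_isComPzRing.Build ring_quot
  rq_mulA rq_mulC rq_mul1 rq_mulDl.

Lemma rq_pi_monoid : monoid_morphism rq_pi.
Proof. by split=> // r t; exact: rq_pi_mul. Qed.

HB.instance Definition _ :=
  GRing.isMonoidMorphism.Build R ring_quot rq_pi rq_pi_monoid.

Lemma ideal_gen_ker (T : comPzRingType) (phi : {rmorphism R -> T}) :
  (forall r, S r -> phi r = 0) -> forall r, ideal_gen r -> phi r = 0.
Proof.
move=> kerS r [s [sS ->]]; rewrite rmorph_sum /= big_seq big1 // => p /sS pS.
by rewrite rmorphM /= (kerS _ pS) mulr0.
Qed.

Lemma rq_repr_pi (T : comPzRingType) (phi : {rmorphism R -> T}) :
  (forall r, S r -> phi r = 0) -> forall r, phi (rq_repr (rq_pi r)) = phi r.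
Proof.
move=> kerS r; apply/eqP; rewrite -subr_eq0 -rmorphB; apply/eqP.
by apply: (ideal_gen_ker kerS); apply/rq_piP; rewrite rq_reprK.
Qed.

End IdealGen.

(* The order [m] of the derivations; [None] is infinity. *)
Definition le_order (i : nat) (m : option nat) : bool :=
  if m is Some n then (i <= n)%N else true.

Definition hs_index (m : option nat) : Type :=
  {i : nat | (0 < i)%N && le_order i m}.
HB.instance Definition _ m := Choice.on (hs_index m).

Definition hs_var (m : option nat) (B : comPzRingType) : Type :=
  (B * hs_index m)%type.
HB.instance Definition _ m B := Choice.on (hs_var m B).

Definition hs_poly (m : option nat) (B : comPzRingType) : Type :=
  polyalg (hs_var m B) B.
HB.instance Definition _ m B := GRing.ComPzRing.on (hs_poly m B).

(* [hs_x m i x] is x^(i), with x^(0) identified with x; the junk value 0 is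
   only reached when [i] exceeds [m]. It is locked because unfolding it makes
   failing unifications diverge. *)
HB.lock Definition hs_x (m : option nat) (B : comPzRingType) (i : nat) (x : B)
    : hs_poly m B :=
  if i == 0%N then paC (hs_var m B) x
  else if insub i is Some j then paX B ((x, j) : hs_var m B) else 0.

Lemma hs_x0 m (B : comPzRingType) (x : B) : hs_x m 0 x = paC (hs_var m B) x.
Proof. by rewrite hs_x.unlock. Qed.

Section HasseSchmidt.
Variables (m : option nat) (A B : comPzRingType) (f : A -> B).
Local Notation hs_x := (@hs_x m B).
Local Notation hs_poly := (hs_poly m B).
Local Notation hs_var := (hs_var m B).

Inductive hs_rel : hs_poly -> Prop :=
| HsAdd (x y : B) i : (0 < i)%N -> le_order i m ->
    hs_rel (hs_x i (x + y) - hs_x i x - hs_x i y)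
| HsBase (a : A) i : (0 < i)%N -> le_order i m -> hs_rel (hs_x i (f a))
| HsMul (x y : B) k : le_order k m ->
    hs_rel (hs_x k (x * y) - \sum_(i < k.+1) hs_x i x * hs_x (k - i) y).

Definition HS : Type := ring_quot hs_rel.
HB.instance Definition _ := GRing.ComPzRing.on HS.

Definition hs_pi : hs_poly -> HS := @rq_pi _ hs_rel.
HB.instance Definition _ := GRing.RMorphism.on hs_pi.

Definition hs_d (i : nat) (x : B) : HS := hs_pi (hs_x i x).

Lemma hs_pi_rel p : hs_rel p -> hs_pi p = 0.
Proof.
move=> rel_p; rewrite -(rmorph0 hs_pi); apply/rq_piP; rewrite subr0.
exact: ideal_gen_mem.
Qed.

Lemma hs_dD i x y : (0 < i)%N -> le_order i m ->
  hs_d i (x + y) = hs_d i x + hs_d i y.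
Proof.
move=> i0 im; apply/eqP; rewrite -subr_eq0 opprD addrA; apply/eqP.
rewrite /hs_d -(rmorphB hs_pi) -(rmorphB hs_pi).
by apply: hs_pi_rel; exact: HsAdd.
Qed.

Lemma hs_d_base i a : (0 < i)%N -> le_order i m -> hs_d i (f a) = 0.
Proof. by move=> i0 im; apply: hs_pi_rel; exact: HsBase. Qed.

Lemma hs_dM k x y : le_order k m ->
  hs_d k (x * y) = \sum_(i < k.+1) hs_d i x * hs_d (k - i) y.
Proof.
move=> km; apply/eqP; rewrite -subr_eq0; apply/eqP.
transitivity (hs_pi (hs_x k (x * y) - \sum_(i < k.+1) hs_x i x * hs_x (k - i) y)).
  rewrite (rmorphB hs_pi) (rmorph_sum hs_pi); congr (_ - _).
  by apply: eq_bigr => i _; rewrite (rmorphM hs_pi).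
by apply: hs_pi_rel; exact: HsMul.
Qed.

Definition hs_C : B -> HS := hs_pi \o @paC hs_var B.
HB.instance Definition _ := GRing.RMorphism.on hs_C.

Definition hs_scale (b : B) (u : HS) : HS := hs_C b * u.

Lemma hs_scaleA a b u : hs_scale a (hs_scale b u) = hs_scale (a * b) u.
Proof. by rewrite /hs_scale (rmorphM hs_C) mulrA. Qed.
Lemma hs_scale1 : left_id 1 hs_scale.
Proof. by move=> u; rewrite /hs_scale (rmorph1 hs_C) mul1r. Qed.
Lemma hs_scaleDr : right_distributive hs_scale +%R.
Proof. by move=> a u v; rewrite /hs_scale mulrDr. Qed.
Lemma hs_scaleDl u : {morph hs_scale^~ u : a b / a + b}.
Proof. by move=> a b; rewrite /hs_scale (rmorphD hs_C) mulrDl. Qed.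

HB.instance Definition _ := GRing.Zmodule_isLmodule.Build B HS
  hs_scaleA hs_scale1 hs_scaleDr hs_scaleDl.

Definition hs_weight (k : {cmonom hs_var}) : nat :=
  (\sum_(v <- finsupp k) k v * val v.2)%N.

Definition HS_deg (n : nat) (u : HS) : Prop :=
  exists p : hs_poly,
    (forall k, k \in msupp p -> hs_weight k = n) /\ u = hs_pi p.

End HasseSchmidt.

Definition restr_scalars (R S : pzRingType) (g : {rmorphism R -> S})
  (V : lmodType S) : Type := V.

Section RestrScalars.
Variables (R S : pzRingType) (g : {rmorphism R -> S}) (V : lmodType S).
Local Notation W := (restr_scalars g V).

HB.instance Definition _ := GRing.Zmodule.on W.

Definition restr_scale (a : R) (v : W) : W := g a *: (v : V).

Lemma restr_scaleA a b v : restr_scale a (restr_scale b v) = restr_scale (a * b) v.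
Proof. by rewrite /restr_scale scalerA rmorphM. Qed.
Lemma restr_scale1 : left_id 1 restr_scale.
Proof. by move=> v; rewrite /restr_scale rmorph1 scale1r. Qed.
Lemma restr_scaleDr : right_distributive restr_scale +%R.
Proof. by move=> a u v; exact: scalerDr. Qed.
Lemma restr_scaleDl v : {morph restr_scale^~ v : a b / a + b}.
Proof. by move=> a b; rewrite /restr_scale rmorphD; exact: scalerDl. Qed.

HB.instance Definition _ := GRing.Zmodule_isLmodule.Build R W
  restr_scaleA restr_scale1 restr_scaleDr restr_scaleDl.

End RestrScalars.

(* [V] is the internal direct sum of the submodules [V_ n]. *)
Definition is_grading (R : pzRingType) (V : lmodType R) (V_ : nat -> V -> Prop)
  : Prop :=
  [/\ forall n, V_ n 0 /\ forall a u v, V_ n u -> V_ n v -> V_ n (a *: u + v),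
      forall v, exists N (u : nat -> V),
        (forall n, V_ n (u n)) /\ v = \sum_(n < N) u n
    & forall N (u : nat -> V), (forall n, V_ n (u n)) ->
        \sum_(n < N) u n = 0 -> forall n, (n < N)%N -> u n = 0].

Record graded_short_exact (R : pzRingType) (U V W : lmodType R)
  (U_ : nat -> U -> Prop) (V_ : nat -> V -> Prop) (W_ : nat -> W -> Prop)
  (i : {linear U -> V}) (p : {linear V -> W}) : Prop := GradedShortExact {
  gse_gradingl : is_grading U_;
  gse_grading : is_grading V_;
  gse_gradingr : is_grading W_;
  gse_homl : forall n u, U_ n u -> V_ n (i u);
  gse_homr : forall n v, V_ n v -> W_ n (p v);
  gse_inj : injective i;
  gse_exact : forall v, p v = 0 <-> exists u, i u = v;
  gse_surj : forall w, exists v, p v = w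
}.

Section Sequence.
Variables (m : option nat) (A B C : comPzRingType).
Variables (f : {rmorphism A -> B}) (g : {rmorphism B -> C}).

Local Notation HSB := (HS m f).
Local Notation HSC := (HS m (g \o f)).
Local Notation HSC_B := (restr_scalars g HSC).

Definition hs_phi0 : B -> HSC := hs_C m (g \o f) \o g.
HB.instance Definition _ := GRing.RMorphism.on hs_phi0.

Definition HS_map_poly : hs_poly m B -> HSC :=
  pa_eval hs_phi0 (fun v : hs_var m B => hs_d m (g \o f) (val v.2) (g v.1)).
HB.instance Definition _ := GRing.RMorphism.on HS_map_poly.

Lemma HS_map_poly_x i b : le_order i m ->
  HS_map_poly (hs_x m i b) = hs_d m (g \o f) i (g b).
Proof.
move=> im; have [->|i0] := eqVneq i 0%N.
  by rewrite hs_x0 /hs_d hs_x0; exact: pa_evalC.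
have ltim : (0 < i)%N && le_order i m by rewrite lt0n i0.
have -> : hs_x m i b = paX B ((b, Sub i ltim) : hs_var m B).
  by rewrite hs_x.unlock (negbTE i0) insubT.
by rewrite [LHS]pa_evalX.
Qed.

(* The natural map, sending d_i b to d_i (g b): see [HS_map_d]. *)
Definition HS_map (u : HSB) : HSC_B := HS_map_poly (rq_repr u).

Lemma HS_map_polyB p q : HS_map_poly (p - q) = HS_map_poly p - HS_map_poly q.
Proof. exact: (rmorphB HS_map_poly). Qed.

Lemma HS_map_polyM p q : HS_map_poly (p * q) = HS_map_poly p * HS_map_poly q.
Proof. exact: (rmorphM HS_map_poly). Qed.

Lemma HS_map_poly_sum n (F : 'I_n -> hs_poly m B) :
  HS_map_poly (\sum_i F i) = \sum_i HS_map_poly (F i).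
Proof. exact: (rmorph_sum HS_map_poly). Qed.

Lemma HS_map_poly_rel p : hs_rel f p -> HS_map_poly p = 0.
Proof.
case=> [x y i i0 im|a i i0 im|x y k km].
- rewrite HS_map_polyB HS_map_polyB !HS_map_poly_x //.
  by rewrite (rmorphD g) hs_dD // -addrA -opprD subrr.
- by rewrite HS_map_poly_x //; exact: (hs_d_base (g \o f)).
- have le_km i : (i <= k)%N -> le_order i m.
    by case: (m) km => //= n kn ik; exact: leq_trans kn.
  rewrite HS_map_polyB HS_map_poly_sum HS_map_poly_x //.
  rewrite (rmorphM g) hs_dM //; apply/eqP; rewrite subr_eq0; apply/eqP.
  apply: eq_bigr => i _; rewrite HS_map_polyM.
  by rewrite !HS_map_poly_x // le_km ?leq_subr // -ltnS.
Qed.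

Lemma HS_map_pi p : HS_map (hs_pi f p) = HS_map_poly p.
Proof. exact: (rq_repr_pi (phi := HS_map_poly) HS_map_poly_rel). Qed.

Lemma HS_map_d i b : le_order i m ->
  HS_map (hs_d m f i b) = hs_d m (g \o f) i (g b).
Proof. by move=> im; rewrite HS_map_pi HS_map_poly_x. Qed.

Lemma hs_piK (u : HSB) : exists p, u = hs_pi f p.
Proof. by exists (rq_repr u); rewrite [RHS]rq_reprK. Qed.

Lemma HS_map_zmod : zmod_morphism HS_map.
Proof.
move=> u v; have [p ->] := hs_piK u; have [q ->] := hs_piK v.
by rewrite -(rmorphB (hs_pi f)) !HS_map_pi (rmorphB HS_map_poly).
Qed.

Lemma HS_map_scalable : scalable HS_map.
Proof.
move=> b u; have [p ->] := hs_piK u.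
have -> : b *: hs_pi f p = hs_pi f (paC _ b * p).
  by rewrite (rmorphM (hs_pi f)).
rewrite !HS_map_pi (rmorphM HS_map_poly); congr (_ * _).
exact: pa_evalC.
Qed.

HB.instance Definition _ := GRing.isZmodMorphism.Build HSB HSC_B HS_map HS_map_zmod.
HB.instance Definition _ :=
  GRing.isScalable.Build B HSB HSC_B *:%R HS_map HS_map_scalable.

(* Generators of the ideal J of the statement, the kernel of B -> C being the
   set of x with g x = 0; [HSker] is J as a B-module. *)
Definition HSker_gen (u : HSB) : Prop :=
  exists i x, [/\ le_order i m, g x = 0 & u = hs_d m f i x].

Definition HSker_pred : {pred HSB} := ideal_pred HSker_gen.

Lemma HSker_submod : submod_closed HSker_pred.
Proof.
split; first by apply/ideal_predP; exact: ideal_gen0.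
move=> b u v /ideal_predP uJ /ideal_predP vJ; apply/ideal_predP.
by apply: ideal_genD => //; exact: ideal_genM.
Qed.
HB.instance Definition _ := GRing.isSubmodClosed.Build B HSB HSker_pred HSker_submod.

Definition HSker : Type := {u : HSB | u \in HSker_pred}.
HB.instance Definition _ := SubChoice.on HSker.
HB.instance Definition _ := [SubChoice_isSubLmodule of HSker by <:].

Definition HSker_incl : HSker -> HSB := val.
HB.instance Definition _ := GRing.Linear.on HSker_incl.

Definition HSker_deg (n : nat) (u : HSker) : Prop := HS_deg n (HSker_incl u).

End Sequence.

(* Main.v *)
Require Import Defs.
From HB Require Import structures.
From mathcomp Require Import all_boot all_order all_algebra.
From mathcomp.finmap Require Import finmap.
From mathcomp.classical Require Import boolp.
From mathcomp.multinomials Require Import monalg.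

Set Implicit Arguments.
Unset Strict Implicit.
Unset Printing Implicit Defensive.

Import GRing.Theory.
Local Open Scope ring_scope.

(** The three terms are graded because every ideal involved is homogeneous, and
    the sequence is exact because [HS(C/A)] has the presentation of
    [HS(B/A) / J].

    Grading.  On the polynomial algebra, with [x^(i)] in degree [i], the map
    [hs_comp n] keeps the terms of weight [n].  For [r] homogeneous of degree
    [d], the component of [a * r] in degree [n] is a multiple of [r], namely
    [r] times the component of [a] in degree [n - d].  Hence an ideal
    with homogeneous generators is stable under taking components
    ([ideal_gen_stable]).  The relations of [HS] are homogeneous
    ([hs_rel_homog]), so components descend to [HS_comp] on [HS]; the
    generators [d_i x] of [J] are homogeneous in [HS], so the components
    preserve [J].  A family of such projections is a grading
    ([grading_of_projections]).  The module [HS(C/A)], graded over [C], stays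
    graded over [B] ([grading_restr_scalars]).

    Exactness.  Surjectivity holds since [HS(C/A)] is generated as a ring by
    the [d_i c], and [J] goes to zero since [d_i 0 = 0].  For the rest, choose
    a set-theoretic section [s] of [g].  If [g x = g y], then
    [d_i x - d_i y = d_i (x - y)] lies in [J] ([piJ_d]), so the class of
    [d_i (s c)] modulo [J] is independent of [s], and [c^(i) |-> d_i (s c)]
    respects addition, multiplication and the elements of [A].  This defines a
    ring morphism from [HS(C/A)] to [HS(B/A) / J] taking the image of [u] to the
    class of [u] ([inv_poly_map]), so an element of the kernel of [HS_map] has
    zero class, that is, lies in [J]. *)

(** * Gradings by projections and homogeneous ideals *)

(** Applying the [n]-th projection to a decomposition of zero isolates its
    [n]-th term, which is how directness follows. *)
Lemma grading_of_projections (R : pzRingType) (V : lmodType R)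
    (V_ : nat -> V -> Prop) (pr : nat -> V -> V) :
  (forall n, V_ n 0 /\ forall a u v, V_ n u -> V_ n v -> V_ n (a *: u + v)) ->
  (forall n, {morph pr n : u v / u + v}) ->
  (forall n v, V_ n (pr n v)) ->
  (forall n e v, V_ e v -> pr n v = if e == n then v else 0) ->
  (forall v, exists N, v = \sum_(n < N) pr n v) ->
  is_grading V_.
Proof.
move=> V_lin prD pr_deg pr_hom pr_fin; split=> // [v|N u uV u0 n ltnN].
  by have [N vE] := pr_fin v; exists N, (pr^~ v).
have pr0 : pr n 0 = 0 by rewrite (pr_hom n n) ?eqxx //; case: (V_lin n).
have : pr n (\sum_(e < N) u e) = u n.
  rewrite (big_morph (pr n) (prD n) pr0) (bigD1 (Ordinal ltnN)) //= big1.
    by rewrite (pr_hom n n) ?eqxx // addr0.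
  move=> e ne; rewrite (pr_hom n e) //; case: eqP => // en.
  by case/eqP: ne; apply: val_inj.
by rewrite u0 pr0.
Qed.

Lemma grading_restr_scalars (R S : pzRingType) (g : {rmorphism R -> S})
    (V : lmodType S) (V_ : nat -> V -> Prop) :
  is_grading V_ -> is_grading (V_ : nat -> restr_scalars g V -> Prop).
Proof.
case=> V_lin V_dec V_dir; split=> // n; have [V0 Vlin] := V_lin n.
by split=> // a u v; exact: Vlin.
Qed.

(** The hypothesis on [pr] is what taking a homogeneous component satisfies when
    the generators in [S] are homogeneous, so the lemma says that such an ideal
    contains the components of its elements. It serves both for the relations
    in the polynomial algebra and for [J] in [HS]. *)
Lemma ideal_gen_stable (R : comPzRingType) (S : R -> Prop) (pr : R -> R) :
  pr 0 = 0 -> {morph pr : x y / x + y} ->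
  (forall a r, S r -> exists b, pr (a * r) = b * r) ->
  forall r, ideal_gen S r -> ideal_gen S (pr r).
Proof.
move=> pr0 prD pr_gen r [s [sS ->]]; rewrite (big_morph pr prD pr0) big_seq.
apply: (big_ind (ideal_gen S)) => [|x y|p /sS pS]; first exact: ideal_gen0.
  exact: ideal_genD.
have [b ->] := pr_gen p.1 p.2 pS.
by apply: ideal_genM; exact: ideal_gen_mem.
Qed.

(** * Induction on generators of a polynomial algebra *)

Section PolyalgGenerators.
Variables (I : choiceType) (R : comPzRingType).

Lemma cmonom_ind (Q : {cmonom I} -> Prop) :
  Q mone -> (forall i k, Q k -> Q (mmul (ucm i) k)) -> forall k, Q k.
Proof.
move=> Q1 QU k; have [n] := ubnP (mdeg k); elim: n => // n IHn in k *.
have [->//|k1] := eqVneq k mone.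
have [i ik] : exists i, i \in finsupp k.
  apply/fset0Pn; apply: contra_neq k1 => k0.
  by apply: mdeg_eq0I; rewrite mdegE k0 big_seq_fset0.
have -> : k = mmul (ucm i) (divcm k (ucm i)).
  apply/eqP/cmP => j; rewrite cmM divcmE cmU.
  by case: eqP => [<-|]; rewrite ?subn0 // subnKC // lt0n cmE_neq0.
by rewrite mdegM mdegU ltnS => deg_k; apply: QU; exact: IHn.
Qed.

(** Stating induction through ring operations and generators, with no reference
    to supports or coefficients, lets it pass to quotients such as [HS]. *)
Lemma pa_gen_ind (Q : polyalg I R -> Prop) :
  (forall p q, Q p -> Q q -> Q (p + q)) ->
  (forall p q, Q p -> Q q -> Q (p * q)) ->
  (forall c, Q (paC I c)) -> (forall i, Q (paX R i)) -> forall p, Q p.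
Proof.
move=> QD QM QC QX; elim/pa_ind => [|//|c k].
  by rewrite -(rmorph0 (@paC I R)); exact: QC.
elim/cmonom_ind: k => [|i k IHk]; first exact: QC.
rewrite -[c]mul1r.
rewrite -[pa_mono _ _]/(pa_mono (1 * c) (mmul (ucm i) k)) -pa_mulUU.
exact: QM (QX i) IHk.
Qed.

End PolyalgGenerators.

(** * Homogeneous components of Hasse-Schmidt polynomials *)

Section Weight.
Variables (m : option nat) (B : comPzRingType).
Local Notation hs_var := (hs_var m B).
Local Notation hs_poly := (hs_poly m B).
Local Notation weight := (@hs_weight m B).
Implicit Types (k l : {cmonom hs_var}) (p q : hs_poly).
Local Open Scope fset_scope.
Local Open Scope ring_scope.

Lemma hs_weight1 : weight mone = 0%N.
Proof. by rewrite /hs_weight mdom1 big_seq_fset0. Qed.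

Lemma hs_weightU v : weight (ucm v) = val v.2.
Proof. by rewrite /hs_weight mdomU big_seq_fset1 cmUU mul1n. Qed.

Lemma hs_weightw (d : {fset hs_var}) k : finsupp k `<=` d ->
  weight k = (\sum_(v <- d) k v * val v.2)%N.
Proof.
move=> le_d; rewrite /hs_weight (big_fset_incl _ le_d) // => v _.
by rewrite -cmE_neq0 negbK => /eqP ->.
Qed.

Lemma hs_weightM k l : weight (mmul k l) = (weight k + weight l)%N.
Proof.
rewrite (hs_weightw (d := finsupp k `|` finsupp l)) ?mdomD //.
rewrite (hs_weightw (fsubsetUl _ (finsupp l))).
rewrite (hs_weightw (fsubsetUr (finsupp k) _)) -big_split /=.
by apply: eq_bigr => v _; rewrite cmM mulnDl.
Qed.

(** This is the condition on representatives in [HS_deg]. *)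
Definition homog n p : Prop := forall k, k \in msupp p -> weight k = n.

Lemma homogP n p : homog n p <-> forall k, weight k != n -> p@_k = 0.
Proof.
split=> hp k.
  by move=> kn; apply/eqP; rewrite mcoeff_eq0; apply: contra kn => /hp ->.
by rewrite -mcoeff_neq0; apply: contraNeq => /hp ->.
Qed.

Lemma homog0 n : homog n 0.
Proof. by move=> k; rewrite msupp0. Qed.

Lemma homogD n p q : homog n p -> homog n q -> homog n (p + q).
Proof.
move=> /homogP hp /homogP hq; apply/homogP => k kn.
by rewrite mcoeffD hp // hq // addr0.
Qed.

Lemma homogN n p : homog n p -> homog n (- p).
Proof. by move=> hp k; rewrite msuppN; exact: hp. Qed.

Lemma homog_mono n c k : weight k = n -> homog n (pa_mono c k).
Proof. by move=> kn l /(fsubsetP msuppU_le); rewrite inE => /eqP ->. Qed.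

Lemma homog_sum n (T : Type) (s : seq T) (P : pred T) (F : T -> hs_poly) :
  (forall x, P x -> homog n (F x)) -> homog n (\sum_(x <- s | P x) F x).
Proof. by move=> hF; apply: big_ind => //; [exact: homog0|exact: homogD]. Qed.

Lemma homogM n e p q : homog n p -> homog e q -> homog (n + e) (p * q).
Proof.
move=> hp hq; rewrite [p * q]pa_mulE !big_seq.
apply: homog_sum => k /hp kn; rewrite big_seq; apply: homog_sum => l /hq le.
by apply: homog_mono; rewrite hs_weightM kn le.
Qed.

Lemma homog_C b : homog 0 (paC hs_var b).
Proof. by apply: homog_mono; exact: hs_weight1. Qed.

Lemma homog_x i b : homog i (hs_x m i b).
Proof.
rewrite hs_x.unlock; case: eqP => [->|_]; first exact: homog_C.
case: insubP => [j _ <-|_]; last exact: homog0.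
by apply: homog_mono; rewrite hs_weightU.
Qed.

(** The Leibniz relation for [(x y)^(k)] is homogeneous because
    [x^(i) * y^(k - i)] has weight [k] for each [i <= k]. *)
Lemma hs_rel_homog (A : comPzRingType) (f : A -> B) r :
  hs_rel f r -> exists d, homog d r.
Proof.
case=> [x y i _ _|a i _ _|x y k _]; [exists i|exists i|exists k].
- by do 2?apply: homogD; try apply: homogN; exact: homog_x.
- exact: homog_x.
apply: homogD; first exact: homog_x.
apply: homogN; apply: homog_sum => i _.
rewrite -[k in homog k _](subnKC (leq_ord i)).
by apply: homogM; exact: homog_x.
Qed.

Definition hs_comp n p : hs_poly :=
  [malg k in msupp p => if weight k == n then p@_k else 0].

Lemma mcoeff_comp n p k :
  (hs_comp n p)@_k = if weight k == n then p@_k else 0.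
Proof.
rewrite mcoeffE; case: ifPn => // /mcoeff_outdom ->.
by case: ifP.
Qed.

Lemma hs_comp_homog n p : homog n (hs_comp n p).
Proof. by apply/homogP => k kn; rewrite mcoeff_comp (negbTE kn). Qed.

Lemma hs_compD n : {morph hs_comp n : p q / p + q}.
Proof.
move=> p q; apply/malgP => k; rewrite mcoeffD !mcoeff_comp mcoeffD.
by case: ifP; rewrite ?addr0.
Qed.

Lemma hs_comp_id n e p : homog e p -> hs_comp n p = if e == n then p else 0.
Proof.
move=> hp; apply/malgP => k; rewrite mcoeff_comp.
have [kn|kn] := eqVneq (weight k) n.
  have [//|en] := eqVneq e n.
  by rewrite mcoeff0; apply: (proj1 (homogP _ _) hp); rewrite kn eq_sym.
case: eqP => [en|_]; last by rewrite mcoeff0.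
by rewrite (proj1 (homogP _ _) hp) // en.
Qed.

Lemma hs_comp0 n : hs_comp n 0 = 0.
Proof. by rewrite (hs_comp_id n (@homog0 n)) eqxx. Qed.

(** The multiplier [b] is the component of [p] in degree [n - d], or [0] if
    [n < d]; writing it as a sum over the terms of [p] whose weight plus [d] is
    [n] covers both cases without subtraction. *)
Lemma hs_compM d n p r :
  homog d r -> exists b, hs_comp n (p * r) = b * r.
Proof.
move=> hr; exists (\sum_(k <- msupp p | (weight k + d)%N == n) pa_mono p@_k k).
rewrite {1}(monalgE p) !mulr_suml.
rewrite (big_morph _ (hs_compD n) (hs_comp0 n)) [RHS]big_mkcond /=.
apply: eq_bigr => k _; apply: hs_comp_id.
by apply: homogM => //; exact: homog_mono.
Qed.

Lemma hs_comp_sum p : exists N, p = \sum_(n < N) hs_comp n p.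
Proof.
exists (\max_(k <- msupp p) (weight k).+1)%N; apply/malgP => k.
rewrite raddf_sum /=; under eq_bigr => n _ do rewrite mcoeff_comp.
have [kp|kp] := boolP (k \in msupp p); last first.
  by rewrite (mcoeff_outdom kp) big1 // => n _; case: ifP.
have ltk : (weight k < \max_(l <- msupp p) (weight l).+1)%N.
  exact: (leq_bigmax_seq _ kp).
rewrite (bigD1 (Ordinal ltk)) //= eqxx big1 ?addr0 // => n nk.
by case: eqP => // kn; case/eqP: nk; apply: val_inj.
Qed.

End Weight.

(** * The grading of the Hasse-Schmidt algebra *)

Section HSGrading.
Variables (m : option nat) (A B : comPzRingType) (f : A -> B).
Local Notation HS := (HS m f).
Local Notation hs_pi := (@hs_pi m A B f).
Local Notation hs_C := (@hs_C m A B f).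
Local Notation hs_d := (@hs_d m A B f).
Implicit Types (u v : HS).

Lemma hs_pi_surj u : exists p, u = hs_pi p.
Proof. by exists (rq_repr u); rewrite [RHS]rq_reprK. Qed.

Lemma hs_d0 b : hs_d 0 b = hs_C b.
Proof. by rewrite /Defs.hs_d hs_x0. Qed.

Lemma hs_dB i x y : le_order i m -> hs_d i (x - y) = hs_d i x - hs_d i y.
Proof.
move=> im; have [->|i0] := eqVneq i 0%N; first by rewrite !hs_d0 (rmorphB hs_C).
apply/eqP; rewrite eq_sym subr_eq -hs_dD ?lt0n //.
by rewrite subrK.
Qed.

(** The elements [d_0 b] are the constants, so the [d_i b] alone generate [HS]
    as a ring. *)
Lemma hs_gen_ind (Q : HS -> Prop) :
  (forall u v, Q u -> Q v -> Q (u + v)) ->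
  (forall u v, Q u -> Q v -> Q (u * v)) ->
  (forall i b, le_order i m -> Q (hs_d i b)) -> forall u, Q u.
Proof.
move=> QD QM Qd u; have [p ->] := hs_pi_surj u.
elim/pa_gen_ind: p => [p q Qp Qq|p q Qp Qq|b|[b [i im]]].
- by rewrite (rmorphD hs_pi); exact: QD.
- by rewrite (rmorphM hs_pi); exact: QM.
- by rewrite -hs_x0; apply: Qd; case: (m).
have /andP[i0 im'] := im.
have -> : paX B (b, exist _ i im) = hs_x m i b.
  rewrite hs_x.unlock -[_ == _]negbK -lt0n i0 /= insubT.
  by congr (paX B (_, _)); apply: val_inj.
exact: Qd.
Qed.

Lemma HS_degD n u v : HS_deg n u -> HS_deg n v -> HS_deg n (u + v).
Proof.
move=> [p [hp ->]] [q [hq ->]]; exists (p + q).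
by rewrite (rmorphD hs_pi); split=> //; exact: homogD.
Qed.

Lemma HS_degM n e u v : HS_deg n u -> HS_deg e v -> HS_deg (n + e) (u * v).
Proof.
move=> [p [hp ->]] [q [hq ->]]; exists (p * q).
by rewrite (rmorphM hs_pi); split=> //; exact: homogM.
Qed.

Lemma HS_degd i b : HS_deg i (hs_d i b).
Proof. by exists (hs_x m i b); split=> //; exact: homog_x. Qed.

Lemma HS_degC b : HS_deg 0 (hs_C b).
Proof. by rewrite -hs_d0; exact: HS_degd. Qed.

Lemma HS_deg_submod n :
  HS_deg n (0 : HS) /\
  forall a u v, HS_deg n u -> HS_deg n v -> HS_deg n (a *: u + v).
Proof.
split=> [|a u v un vn].
  by exists 0; split; [exact: homog0 | rewrite (rmorph0 hs_pi)].
by apply: HS_degD => //; exact: (HS_degM (HS_degC a) un).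
Qed.

Definition HS_comp n u : HS := hs_pi (hs_comp n (rq_repr u)).

(** Independence of the representative is the homogeneity of the ideal of
    relations. *)
Lemma HS_comp_pi n p : HS_comp n (hs_pi p) = hs_pi (hs_comp n p).
Proof.
apply/rq_piP; set q := rq_repr _.
have -> : hs_comp n q - hs_comp n p = hs_comp n (q - p).
  by rewrite -[in LHS](subrK p q) hs_compD addrK.
apply: ideal_gen_stable; [exact: hs_comp0 | exact: hs_compD | |].
  by move=> a r /hs_rel_homog[d hr]; exact: hs_compM hr.
by apply/rq_piP; exact: rq_reprK.
Qed.

Lemma HS_compD n : {morph HS_comp n : u v / u + v}.
Proof.
move=> u v; have [p ->] := hs_pi_surj u; have [q ->] := hs_pi_surj v.
by rewrite -(rmorphD hs_pi) !HS_comp_pi hs_compD (rmorphD hs_pi).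
Qed.

Lemma HS_comp_deg n u : HS_deg n (HS_comp n u).
Proof. by exists (hs_comp n (rq_repr u)); split=> //; exact: hs_comp_homog. Qed.

Lemma HS_comp_id n e u : HS_deg e u -> HS_comp n u = if e == n then u else 0.
Proof.
move=> [p [hp ->]]; rewrite HS_comp_pi (hs_comp_id n hp).
by case: ifP; rewrite ?(rmorph0 hs_pi).
Qed.

Lemma HS_comp0 n : HS_comp n 0 = 0.
Proof. by rewrite (HS_comp_id n (HS_deg_submod n).1) eqxx. Qed.

Lemma HS_compM d n u v : HS_deg d v -> exists b, HS_comp n (u * v) = b * v.
Proof.
have [p ->] := hs_pi_surj u; move=> [q [hq ->]].
have [b bE] := hs_compM n p hq; exists (hs_pi b).
by rewrite -!(rmorphM hs_pi) HS_comp_pi bE.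
Qed.

Lemma HS_comp_sum u : exists N, u = \sum_(n < N) HS_comp n u.
Proof.
have [p ->] := hs_pi_surj u; have [N pE] := hs_comp_sum p; exists N.
rewrite {1}pE (rmorph_sum hs_pi); apply: eq_bigr => n _.
by rewrite HS_comp_pi.
Qed.

Lemma HS_grading : is_grading (@HS_deg m A B f).
Proof.
exact: grading_of_projections HS_deg_submod HS_compD HS_comp_deg HS_comp_id
  HS_comp_sum.
Qed.

End HSGrading.

(** * The kernel ideal and the natural map *)

Section HSMap.
Variables (m : option nat) (A B C : comPzRingType).
Variables (f : {rmorphism A -> B}) (g : {rmorphism B -> C}).
Local Notation HSB := (HS m f).
Local Notation HSC := (HS m (g \o f)).
Local Notation HSker := (@HSker m A B C f g).
Local Notation incl := (@HSker_incl m A B C f g).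
Local Notation HS_map := (@HS_map m A B C f g).
Local Notation J := (@HSker_gen m A B C f g).
Local Notation dB := (@hs_d m A B f).
Local Notation dC := (@hs_d m A C (g \o f)).

Lemma HSker_comp n (u : HSB) : ideal_gen J u -> ideal_gen J (HS_comp n u).
Proof.
apply: ideal_gen_stable; [exact: HS_comp0 | exact: HS_compD |].
move=> a _ [i [x [_ _ ->]]]; apply: (HS_compM n a); exact: HS_degd.
Qed.

Definition HSker_proj n (u : HSker) : HSker :=
  Sub (HS_comp n (incl u))
    (introT (ideal_predP J _)
       (HSker_comp n (elimT (ideal_predP J _) (valP u)))).

Lemma HSker_incl_inj : injective incl.
Proof. exact: val_inj. Qed.

Lemma HSker_projE n u : incl (HSker_proj n u) = HS_comp n (incl u).
Proof. by rewrite /HSker_incl SubK. Qed.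

Lemma HSker_grading : is_grading (@HSker_deg m A B C f g).
Proof.
apply: (@grading_of_projections _ _ _ HSker_proj).
- move=> n; have [deg0 degZD] := HS_deg_submod m f n.
  split=> [|a u v]; rewrite /HSker_deg; first by rewrite (raddf0 incl).
  by rewrite (linearP incl); exact: degZD.
- move=> n u v; apply: HSker_incl_inj.
  by rewrite [RHS](raddfD incl) !HSker_projE -HS_compD.
- by move=> n u; rewrite /HSker_deg HSker_projE; exact: HS_comp_deg.
- move=> n e u ue; apply: HSker_incl_inj.
  by rewrite HSker_projE (HS_comp_id n ue); case: ifP; rewrite ?(raddf0 incl).
move=> u; have [N uE] := HS_comp_sum (incl u); exists N.
apply: HSker_incl_inj; rewrite [LHS]uE (raddf_sum incl).
by apply: eq_bigr => n _; exact/esym/HSker_projE.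
Qed.

Lemma HS_mapM (u v : HSB) : HS_map (u * v) = (HS_map u : HSC) * HS_map v.
Proof.
have [p ->] := hs_pi_surj u; have [q ->] := hs_pi_surj v.
by rewrite -(rmorphM (hs_pi f)) !HS_map_pi HS_map_polyM.
Qed.

Lemma HS_map_ker (u : HSB) : ideal_gen J u -> HS_map u = 0.
Proof.
case=> s [sJ ->]; rewrite (raddf_sum HS_map) big_seq big1 // => p /sJ.
case=> i [x [im gx0 ->]]; rewrite [LHS]HS_mapM HS_map_d // gx0.
by rewrite -(subrr 0) hs_dB // subrr mulr0.
Qed.

Lemma HS_map_surj : (forall c, exists b, g b = c) ->
  forall w, exists u, HS_map u = w.
Proof.
move=> g_surj; apply: (@hs_gen_ind m A C (g \o f)).
- by move=> _ _ [u <-] [v <-]; exists (u + v); rewrite (raddfD HS_map).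
- by move=> _ _ [u <-] [v <-]; exists (u * v); rewrite HS_mapM.
by move=> i c im; have [b <-] := g_surj c; exists (dB i b); rewrite HS_map_d.
Qed.

(** Degrees are preserved because the image of a monomial is a product of a
    degree zero constant and of elements [d_i (g b)], one for each variable
    [b^(i)] with multiplicity. *)
Lemma HS_map_deg n (u : HSB) : HS_deg n u -> HS_deg n (HS_map u : HSC).
Proof.
move=> [p [hp ->]]; rewrite HS_map_pi.
have [deg0 _] := HS_deg_submod m (g \o f) n.
rewrite /HS_map_poly /pa_eval big_seq.
apply: (big_ind (@HS_deg m A C (g \o f) n)) => // [u1 u2|k /hp <-].
  exact: HS_degD.
rewrite -[hs_weight k]add0n; apply: HS_degM; first exact: HS_degC.
rewrite /mon_eval /hs_weight.
apply: (big_ind2 (fun u e => @HS_deg m A C (g \o f) e u)).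
- by rewrite -(rmorph1 (hs_C m (g \o f))); exact: HS_degC.
- by move=> u1 e1 u2 e2; exact: HS_degM.
move=> v _; elim: (k v) => [|e IHe].
  by rewrite expr0 mul0n -(rmorph1 (hs_C m (g \o f))); exact: HS_degC.
by rewrite exprS mulSn; apply: HS_degM => //; exact: HS_degd.
Qed.

End HSMap.

(** * The inverse of the natural map modulo the kernel ideal *)

Section Inverse.
Variables (m : option nat) (A B C : comPzRingType).
Variables (f : {rmorphism A -> B}) (g : {rmorphism B -> C}).
Variables (s : C -> B) (sK : cancel s g).
Local Notation HSB := (HS m f).
Local Notation HSC := (HS m (g \o f)).
Local Notation HS_map := (@HS_map m A B C f g).
Local Notation J := (@HSker_gen m A B C f g).
Local Notation dB := (@hs_d m A B f).
Local Notation dC := (@hs_d m A C (g \o f)).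
Local Notation piC := (@hs_pi m A C (g \o f)).
Local Notation Q := (ring_quot J).
Local Notation piJ := (@rq_pi HSB J).

(** This makes the choice of preimages in [B] irrelevant modulo [J]; every
    identity that fails for the section [s] but holds after applying [g] becomes
    true in the quotient. *)
Lemma piJ_d i x y : le_order i m -> g x = g y -> piJ (dB i x) = piJ (dB i y).
Proof.
move=> im gxy; apply/rq_piP; rewrite -hs_dB //; apply: ideal_gen_mem.
by exists i, (x - y); rewrite (rmorphB g) gxy subrr.
Qed.

Definition inv_C (c : C) : Q := piJ (dB 0 (s c)).

Lemma le_order0 : le_order 0 m.
Proof. by case: (m). Qed.

Lemma inv_C_zmod : zmod_morphism inv_C.
Proof.
move=> c c'; rewrite /inv_C -(rmorphB piJ) -hs_dB ?le_order0 //.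
by apply: piJ_d; rewrite ?le_order0 // (rmorphB g) !sK.
Qed.

Lemma inv_C_monoid : monoid_morphism inv_C.
Proof.
split=> [|c c']; rewrite /inv_C.
  transitivity (piJ (dB 0 1)).
    by apply: piJ_d; rewrite ?le_order0 // sK (rmorph1 g).
  by rewrite hs_d0 (rmorph1 (hs_C m f)) (rmorph1 piJ).
transitivity (piJ (dB 0 (s c * s c'))).
  by apply: piJ_d; rewrite ?le_order0 // (rmorphM g) !sK.
by rewrite !hs_d0 (rmorphM (hs_C m f)) (rmorphM piJ).
Qed.

HB.instance Definition _ := GRing.isZmodMorphism.Build C Q inv_C inv_C_zmod.
HB.instance Definition _ := GRing.isMonoidMorphism.Build C Q inv_C inv_C_monoid.

Definition inv_poly : hs_poly m C -> Q :=
  pa_eval inv_C (fun v : hs_var m C => piJ (dB (val v.2) (s v.1))).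
HB.instance Definition _ := GRing.RMorphism.on inv_poly.

Lemma inv_polyB p q : inv_poly (p - q) = inv_poly p - inv_poly q.
Proof. exact: (rmorphB inv_poly). Qed.

Lemma inv_polyM p q : inv_poly (p * q) = inv_poly p * inv_poly q.
Proof. exact: (rmorphM inv_poly). Qed.

Lemma inv_poly_x i c : le_order i m -> inv_poly (hs_x m i c) = piJ (dB i (s c)).
Proof.
move=> im; have [->|i0] := eqVneq i 0%N.
  by rewrite hs_x0; exact: pa_evalC.
have ltim : (0 < i)%N && le_order i m by rewrite lt0n i0.
have -> : hs_x m i c = paX C ((c, Sub i ltim) : hs_var m C).
  by rewrite hs_x.unlock (negbTE i0) insubT.
by rewrite [LHS]pa_evalX.
Qed.

(** Since [s] preserves sums, products and elements of [A] only up to the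
    kernel of [g], each relation is first moved by [piJ_d] to the corresponding
    relation of [HS(B/A)] on the lifts. *)
Lemma inv_poly_rel p : hs_rel (g \o f) p -> inv_poly p = 0.
Proof.
case=> [x y i i0 im|a i i0 im|x y k km].
- rewrite !inv_polyB !inv_poly_x // -!(rmorphB piJ) -!hs_dB //.
  (* The target [0] is written as [d_i (f 0)] so that [piJ_d] applies. *)
  rewrite -(rmorph0 piJ) -(hs_d_base (m := m) f 0 i0 im) (rmorph0 f).
  apply: piJ_d => //; rewrite !(rmorphB g) !sK (rmorph0 g).
  by rewrite [x + y]addrC addrK subrr.
- rewrite inv_poly_x // -(rmorph0 piJ) -(hs_d_base (m := m) f a i0 im).
  by apply: piJ_d; rewrite ?sK.
have le_km i : (i <= k)%N -> le_order i m.
  by case: (m) km => //= n kn ik; exact: leq_trans kn.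
apply/eqP; rewrite inv_polyB subr_eq0 inv_poly_x //; apply/eqP.
transitivity (piJ (dB k (s x * s y))).
  by apply: piJ_d; rewrite ?(rmorphM g) ?sK.
rewrite hs_dM // (rmorph_sum piJ) (rmorph_sum inv_poly); apply: eq_bigr => i _.
rewrite [LHS](rmorphM piJ) [RHS]inv_polyM.
by rewrite !inv_poly_x // le_km ?leq_subr // -ltnS.
Qed.

(** The polynomial [q] stands for an element of [HS(C/A)]: this says that the
    morphism induced by [inv_poly] sends [HS_map u] to the class of [u],
    phrased on representatives so as to use induction on [u]. *)
Lemma inv_poly_map (u : HSB) :
  exists2 q, HS_map u = piC q & inv_poly q = piJ u.
Proof.
elim/hs_gen_ind: u => [u v [p up pu] [q vq qv]|u v [p up pu] [q vq qv]|i b im].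
- exists (p + q).
    by rewrite [LHS](raddfD HS_map) [RHS](rmorphD piC); exact: congr2 up vq.
  by rewrite [LHS](rmorphD inv_poly) [RHS](rmorphD piJ); exact: congr2 pu qv.
- exists (p * q).
    by rewrite HS_mapM [RHS](rmorphM piC); exact: congr2 up vq.
  by rewrite inv_polyM [RHS](rmorphM piJ); exact: congr2 pu qv.
exists (hs_x m i (g b)); first by rewrite HS_map_d.
by rewrite inv_poly_x //; apply: piJ_d; rewrite ?sK.
Qed.

Lemma HS_map_eq0 (u : HSB) : HS_map u = 0 -> ideal_gen J u.
Proof.
have [q -> qu] := inv_poly_map u; rewrite -(rmorph0 piC) => /rq_piP q0.
rewrite -[u]subr0; apply/rq_piP; rewrite -qu (rmorph0 piJ).
by apply: (ideal_gen_ker inv_poly_rel); rewrite -[q]subr0.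
Qed.

End Inverse.

Theorem theorem2p2 (A B C : comPzRingType)
  (f : {rmorphism A -> B}) (g : {rmorphism B -> C}) (m : option nat)
  (g_surj : forall c : C, exists b : B, g b = c) :
  graded_short_exact
    (@HSker_deg m A B C f g)
    (@HS_deg m A B f)
    (@HS_deg m A C (g \o f) : nat -> restr_scalars g (HS m (g \o f)) -> Prop)
    (@HSker_incl m A B C f g)
    (@HS_map m A B C f g).
Proof.
have [s sK] := choice g_surj.
split.
- exact: HSker_grading.
- exact: HS_grading.
- exact: grading_restr_scalars (HS_grading m (g \o f)).
- by [].
- exact: HS_map_deg.
- exact: HSker_incl_inj.
- move=> v; split=> [v0|[u <-]]; last first.
    by apply: HS_map_ker; apply/ideal_predP; exact: (valP u).
  have vJ : v \in @HSker_pred m A B C f g.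
    by apply/ideal_predP; exact: (HS_map_eq0 sK v0).
  by exists (Sub v vJ); exact: SubK.
- exact: HS_map_surj.
Qed.
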